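(* For every $2\le m,n\le\infty$, the metric space associated with $T_{m,n}$ has no stationary independence relation. It has a local stationary independence relation if and only if $m=\infty$ and $n\in\{2,3,\infty\}$.
   Context: $T_{m,n}$ is the countable connected regular tree-like graph in which every block is a clique of order $n$ and every vertex is a cut vertex lying in exactly $m$ blocks; its associated metric space has the vertices as points and the shortest-path distance (a homogeneous structure). A ternary relation $\perp$ on finite substructures of a homogeneous structure $\mathbf M$ is a stationary independence relation if it satisfies: Invariance (depends only on the type of $(\mathbf A,\mathbf B,\mathbf C)$); Symmetry ($\mathbf A\perp_{\mathbf C}\mathbf B\Rightarrow\mathbf B\perp_{\mathbf C}\mathbf A$); Monotonicity ($\mathbf A\perp_{\mathbf C}\langle\mathbf B\mathbf D\rangle\Rightarrow\mathbf A\perp_{\mathbf C}\mathbf B$ and $\mathbf A\perp_{\langle\mathbf B\mathbf C\rangle}\mathbf D$, where $\langle\cdot\rangle$ is the substructure on the union); Existence (for all $\mathbf A,\mathbf B,\mathbf C$ some $\mathbf A'$ of the same type as $\mathbf A$ over $\mathbf C$ has $\mathbf A'\perp_{\mathbf C}\mathbf B$); Stationarity (if $\mathbf A,\mathbf A'$ have the same type over $\mathbf C$ and both are independent from $\mathbf B$ over $\mathbf C$, they have the same type over $\langle\mathbf B\mathbf C\rangle$). It is local if it is defined only for nonempty $\mathbf C$. *)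

(* Defs.v *)
From mathcomp Require Import all_boot finmap.
From mathcomp Require Import boolp classical_sets functions cardinality.

Set Implicit Arguments.
Unset Strict Implicit.
Unset Printing Implicit Defensive.

Local Open Scope classical_set_scope.
Local Open Scope card_scope.

(** ** Cardinals at most countable *)

Inductive natbar := Fin of nat | Infty.

Definition le_natbar (k : nat) (m : natbar) : bool :=
  if m is Fin m' then k <= m' else true.

Definition has_card (T : Type) (A : set T) (m : natbar) : Prop :=
  if m is Fin m' then A #= `I_m' else A #= [set: nat].

(** ** Graphs: a set of vertices stands for the subgraph it induces *)

Section Graph.
Variables (V : countType) (e : rel V).

Definition joined (S : set V) (x y : V) : Prop :=
  exists p : seq V,
    [/\ path e x p, last x p = y & forall z, z \in x :: p -> S z].

Definition connected_in (S : set V) : Prop :=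
  S !=set0 /\ forall x y, S x -> S y -> joined S x y.

(* Deleting v separates two vertices of the same component. *)
Definition cut_vertex (S : set V) (v : V) : Prop :=
  S v /\ exists x y, [/\ joined S x y, x <> v, y <> v
                       & ~ joined (S `\ v) x y].

Definition connected_nocut (S : set V) : Prop :=
  connected_in S /\ forall v, ~ cut_vertex S v.

(* A block is a maximal connected subgraph without a cut vertex of its own;
   by maximality it is an induced subgraph, so its vertex set determines it. *)
Definition block (B : set V) : Prop :=
  connected_nocut B /\
  forall B' : set V, B `<=` B' -> connected_nocut B' -> B' = B.

Definition clique (S : set V) : Prop :=
  forall x y, S x -> S y -> x <> y -> e x y.

(* (V, e) is (a copy of) the graph T_{m,n}, which these conditions determine
   up to isomorphism. *)
Record is_Tmn (m n : natbar) : Prop := IsTmn {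
  Tmn_sym : symmetric e;
  Tmn_irr : irreflexive e;
  Tmn_connected : connected_in setT;
  Tmn_block : forall B, block B -> clique B /\ has_card B n;
  Tmn_vertex : forall v, cut_vertex setT v /\
                         has_card [set B | block B /\ B v] m }.

Definition walk (x y : V) (k : nat) : Prop :=
  exists p : seq V, [/\ path e x p, last x p = y & size p = k].

(* Shortest-path distance; the value 0 for unconnected vertices is junk. *)
Definition gdist (x y : V) : nat :=
  if pselect (exists k, `[< walk x y k >]) is left xy then ex_minn xy else 0.

End Graph.

(** ** First-order types in a metric space with distances in nat *)

(* First-order formulas with free variables in X, over the language with one
   binary relation "the distance is k" for each k; [All] binds [None]. *)
Inductive formula (X : Type) : Type :=
| Eq of X & X
| Dist of nat & X & X
| Bot
| Imp of formula X & formula X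
| All of formula (option X).

Section Metric.
Variables (M : choiceType) (d : M -> M -> nat).

Fixpoint sat (X : Type) (phi : formula X) : (X -> M) -> Prop :=
  match phi with
  | Eq x y => fun s => s x = s y
  | Dist k x y => fun s => d (s x) (s y) = k
  | Bot => fun _ => False
  | Imp phi1 phi2 => fun s => sat phi1 s -> sat phi2 s
  | All phi1 => fun s => forall a : M, sat phi1 (fun u => oapp s a u)
  end.

(* The type of the tuple a over C. An element of C in a formula is a
   parameter and denotes itself. *)
Definition tp (k : nat) (a : k.-tuple M) (C : {fset M}) :
    set (formula ('I_k + C)) :=
  [set phi | sat phi (fun u => match u with
                               | inl i => tnth a i
                               | inr c => val c
                               end)].

#[global] Arguments tp {k} a C.

Definition elems (k : nat) (a : k.-tuple M) : {fset M} := [fset x in tval a]%fset.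

(** ** Stationary independence relations *)

(* The language is relational: finite substructures are finite sets, the empty
   one included, and <B C> is the union. [ind A C B] reads "A is independent
   from B over C", and is only considered for C in [base]. The type of a finite
   substructure is, as usual, the type of a tuple enumerating it. *)
Record SIR_over (base : {fset M} -> Prop)
    (ind : {fset M} -> {fset M} -> {fset M} -> Prop) : Prop := SIROver {
  SIR_invariance : forall (ka kb kc : nat) (a a' : ka.-tuple M)
      (b b' : kb.-tuple M) (c c' : kc.-tuple M),
    base (elems c) -> base (elems c') ->
    tp [tuple of a ++ b ++ c] fset0 = tp [tuple of a' ++ b' ++ c'] fset0 ->
    ind (elems a) (elems c) (elems b) ->
    ind (elems a') (elems c') (elems b');
  SIR_symmetry : forall A B C, base C -> ind A C B -> ind B C A;
  SIR_monotonicity : forall A B C D, base C ->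
    ind A C (B `|` D)%fset -> ind A C B /\ ind A (B `|` C)%fset D;
  SIR_existence : forall (k : nat) (a : k.-tuple M) (B C : {fset M}),
    base C ->
    exists a' : k.-tuple M, tp a' C = tp a C /\ ind (elems a') C B;
  SIR_stationarity : forall (k : nat) (a a' : k.-tuple M) (B C : {fset M}),
    base C -> tp a C = tp a' C ->
    ind (elems a) C B -> ind (elems a') C B ->
    tp a (B `|` C)%fset = tp a' (B `|` C)%fset }.

Definition has_SIR : Prop :=
  exists ind, SIR_over (fun=> True) ind.

Definition has_local_SIR : Prop :=
  exists ind, SIR_over (fun C => C <> fset0) ind.

End Metric.

(* Main.v *)
Require Import Defs.
From mathcomp Require Import all_boot finmap.
From mathcomp Require Import boolp classical_sets cardinality.
From mathcomp Require Import zify.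

(** Since the blocks are cliques, every vertex has a gate in every block, and the
    graph distance satisfies the four-point condition. It follows that finite
    partial isometries extend by one point (it is enough to add a neighbour a of a
    point c of the domain, by looking at the first steps from c), so that types
    are determined by distances.

    If a' is independent from b1 and b2 over C, and b1, b2 have the same type over
    C, then a' is equidistant from b1 and b2. This is impossible for C empty and
    the vertices of an induced path of length 2; for C = {c} and one neighbour of c
    in each block, if there are finitely many; and for C an edge and the remaining
    vertices of its block, if there are at least 2 and finitely many.

    In the other cases, call a and b independent over C if the geodesic from a to b
    meets the convex hull of C in the tree of vertices and blocks; if n <= 3 the
    hull is enlarged by all vertices of the blocks in it. In terms of the doubled
    Gromov product g at b: g(c, c') <= g(a, c) for some c, c' in C, and if n <= 3
    the same for the integer parts of g / 2. *)

Set Implicit Arguments.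
Unset Strict Implicit.
Unset Printing Implicit Defensive.

Local Open Scope classical_set_scope.
Local Open Scope card_scope.

(** * Finite cardinals and lists *)

Lemma has_card_seq (T : choiceType) (A : set T) k : has_card A (Fin k) ->
  exists s : seq T, [/\ uniq s, size s = k & forall x, A x <-> x \in s].
Proof.
move=> /= Ak; have fA : finite_set A by exists k.
exists (fset_set A : seq T); split; [exact: fset_uniq|exact: card_fset_set|].
by move=> x; have := in_fset_set fA x => ->; rewrite inE.
Qed.

Lemma has_card_infty_seq (T : choiceType) (A : set T) (s : seq T) :
  has_card A Infty -> exists2 x, A x & x \notin s.
Proof.
move=> /= Ainf; apply: contrapT => nx; have: finite_set A.
  apply: (@sub_finite_set _ _ [set` s]); last by apply/finite_seqP; exists s.
  move=> x Ax /=; apply: contrapT => /negP xs; by apply: nx; exists x.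
by rewrite (eq_finite_set Ainf) => /infinite_nat.
Qed.

(* Pigeonhole: P is a finite partial bijection from A to A' whose domain misses k0,
   hence its range misses a point of A'. *)
Lemma has_card_avoid (T : choiceType) (A A' : set T) k (P : seq (T * T)) k0 (L : seq T) :
    has_card A k -> has_card A' k -> A k0 ->
    (forall p, p \in P -> A p.1 /\ p.1 <> k0) ->
    (forall p q, p \in P -> q \in P -> p.1 = q.1 <-> p.2 = q.2) ->
  exists2 y, A' y & y \notin map snd P /\ (k = Infty -> y \notin L).
Proof.
case: k => [k|] cA cA' Ak0 PA Pinj; last first.
  have [y Ay] := has_card_infty_seq (map snd P ++ L) cA'.
  by rewrite mem_cat => /norP[yP yL]; exists y.
have [s [us ss sA]] := has_card_seq cA; have [s' [us' ss' sA']] := has_card_seq cA'.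
apply: contrapT => ny.
have s'P : {subset s' <= map snd (undup P)}.
  move=> y ys; have: y \in map snd P.
    by apply: contrapT => /negP yP; apply: ny; exists y; [exact/sA'|].
  by move=> /mapP[p pP ->]; apply: map_f; rewrite mem_undup.
have uP : uniq (k0 :: map fst (undup P)).
  rewrite cons_uniq map_inj_in_uniq ?undup_uniq ?andbT.
    apply/negP => /mapP[p]; rewrite mem_undup => /PA[_ pk] /esym//.
  move=> p q; rewrite !mem_undup => pP qP pq; have := Pinj p q pP qP.
  by case: p q pq {pP qP} => [p1 p2] [q1 q2] /= -> [/(_ erefl)->].
have sub : {subset k0 :: map fst (undup P) <= s}.
  move=> x; rewrite inE => /predU1P[->|/mapP[p]]; first exact/sA.
  by rewrite mem_undup => /PA[/sA ? _] ->.
have := uniq_leq_size us' s'P; have := uniq_leq_size uP sub.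
by rewrite /= !size_map ss ss' => h1 h2; have := leq_trans h1 h2; rewrite ltnn.
Qed.

Lemma has_card_ge2 (T : choiceType) (A : set T) k (v : T) :
  le_natbar 2 k -> has_card A k -> exists2 w, A w & w <> v.
Proof.
case: k => [k|] k2 cA.
  have [[|x [|y s]] [us sk sA]] := has_card_seq cA; rewrite -sk // in k2.
  have [xv|] := pselect (x = v); last by exists x => //; apply/sA; rewrite mem_head.
  exists y; first by apply/sA; rewrite !inE eqxx orbT.
  by move=> yv; rewrite xv yv /= inE eqxx in us.
by have [w Aw] := has_card_infty_seq [:: v] cA; rewrite inE => /eqP; exists w.
Qed.

(** * Blocks of cliques and the four-point condition *)

(** For adjacent a and c this is the block of the edge ac ([edge_blockE]), expressed through
    distances alone. *)
Definition blk (V : Type) (d : V -> V -> nat) (a c : V) : set V :=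
  [set z | d z a <= 1 /\ d z c <= 1].

(** Neighbours of v in one block give the same set, so the cardinality counts blocks and not
    neighbours. *)
Definition blocks_at (V : Type) (d : V -> V -> nat) (v : V) : set (set V) :=
  [set B | exists2 w, d v w = 1 & B = blk d v w].

Record block_metric (V : choiceType) (d : V -> V -> nat) (m n : natbar) : Prop :=
  BlockMetric {
    bm_eq0 : forall x y, d x y = 0 <-> x = y;
    bm_sym : forall x y, d x y = d y x;
    bm_step : forall x y k, d x y = k.+1 -> exists2 z, d x z = 1 & d z y = k;
    bm_four : forall x y z w,
      d x y + d z w <= maxn (d x z + d y w) (d x w + d y z);
    bm_blk : forall a c, d a c = 1 -> has_card (blk d a c) n;
    bm_deg : forall v, has_card (blocks_at d v) m }.

(** * Connectivity, blocks and ears *)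

Section Joined.
Variables (V : countType) (e : rel V).
Hypothesis e_sym : symmetric e.

Lemma joined_refl (S : set V) x : S x -> joined e S x x.
Proof. by move=> Sx; exists [::]; split=> // z; rewrite inE => /eqP->. Qed.

Lemma joined_sym (S : set V) x y : joined e S x y -> joined e S y x.
Proof.
move=> [p [ep lp Sp]]; exists (rev (belast x p)); split.
- by rewrite -lp rev_path; apply: sub_path ep => u v; rewrite e_sym.
- by case: p {ep Sp} lp => //= u p _; rewrite rev_cons last_rcons.
- move=> z zp; apply: Sp; move: zp.
  by rewrite -lp inE mem_rev => /predU1P[->|/mem_belast//]; rewrite mem_last.
Qed.

Lemma joined_trans (S : set V) y x z :
  joined e S x y -> joined e S y z -> joined e S x z.
Proof.
move=> [p [ep lp Sp]] [q [eq lq Sq]]; exists (p ++ q); split.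
- by rewrite cat_path ep lp.
- by rewrite last_cat lp.
- move=> w; rewrite -cat_cons mem_cat => /orP[/Sp//|wq].
  by apply: Sq; rewrite inE wq orbT.
Qed.

Lemma joined_edge (S : set V) x y : S x -> S y -> e x y -> joined e S x y.
Proof.
move=> Sx Sy exy; exists [:: y]; split=> //=; first by rewrite exy.
by move=> z; rewrite !inE => /orP[] /eqP->.
Qed.

Lemma joined_sub (S T : set V) x y : S `<=` T -> joined e S x y -> joined e T x y.
Proof. by move=> ST [p [ep lp Sp]]; exists p; split=> // z /Sp/ST. Qed.

Lemma nocut_joined (S : set V) v x y : connected_nocut e S ->
  S x -> S y -> x <> v -> y <> v -> joined e (S `\ v) x y.
Proof.
move=> [[_ cS] ncS] Sx Sy xv yv; have Sxy := cS _ _ Sx Sy.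
apply: contrapT => nj; have [Sv|nSv] := pselect (S v).
  by apply: (ncS v); split=> //; exists x, y.
by apply: nj; apply: joined_sub Sxy => z Sz; split=> // zv; apply: nSv; rewrite -zv.
Qed.

Definition edge_block (a c : V) : set V :=
  [set z | exists S, [/\ connected_nocut e S, S a, S c & S z]].

Lemma edge_nocut a c : e a c -> connected_nocut e [set a; c].
Proof.
move=> eac; have Sa : [set a; c] a by left.
have Sc : [set a; c] c by right.
have eca : e c a by rewrite e_sym.
split.
  split; first by exists a.
  by move=> x y [->|->] [->|->]; (exact: joined_refl || exact: joined_edge).
move=> v [_ [x [y [Sxy xv yv []]]]].
have Sx : [set a; c] x by case: Sxy => p [_ _]; apply; rewrite mem_head.
have Sy : [set a; c] y by case: Sxy => p [_ <-]; apply; rewrite mem_last.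
case: Sx Sy => -> [->|->] in xv yv Sxy *;
  by [apply: joined_refl; split|apply: joined_edge; rewrite //; split].
Qed.

(** Any two of the sets united in [edge_block] share a and c, and deleting one vertex leaves a or c
    in place. So the union is connected without a cut vertex, and it is the largest such set through
    a and c. *)
Lemma edge_blockP a c : irreflexive e -> e a c ->
  [/\ block e (edge_block a c), edge_block a c a & edge_block a c c].
Proof.
move=> e_irr eac; have nc := edge_nocut eac.
have Ka : edge_block a c a by exists [set a; c]; split=> //; (left + right).
have Kc : edge_block a c c by exists [set a; c]; split=> //; (left + right).
have sub S : connected_nocut e S -> S a -> S c -> S `<=` edge_block a c.
  by move=> ncS Sa Sc z Sz; exists S.
split=> //; split; last first.
  move=> B' KB ncB; apply/seteqP; split=> //; apply: sub => //; exact: KB.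
split.
  split; first by exists a.
  have toa x : edge_block a c x -> joined e (edge_block a c) x a.
    move=> [S [ncS Sa Sc Sx]]; apply: (@joined_sub S); first exact: sub.
    by case: ncS => [[_ cS] _]; exact: cS.
  by move=> x y /toa xa /toa /joined_sym; apply: joined_trans.
move=> v [_ [x [y [Kxy xv yv []]]]].
have Kx : edge_block a c x by case: Kxy => p [_ _]; apply; rewrite mem_head.
have Ky : edge_block a c y by case: Kxy => p [_ <-]; apply; rewrite mem_last.
have [w [wv wac]] : exists w, w <> v /\ (w = a \/ w = c).
  have [av|] := pselect (a = v); last by exists a; split=> //; left.
  by exists c; split; [move=> cv; move: eac; rewrite av cv e_irr|right].
have tow z : edge_block a c z -> z <> v -> joined e (edge_block a c `\ v) z w.
  move=> [S [ncS Sa Sc Sz]] zv; apply: (@joined_sub (S `\ v)).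
    by move=> u [Su uv]; split=> //; exists S.
  by apply: nocut_joined => //; case: wac => ->.
exact: joined_trans (tow _ Kx xv) (joined_sym (tow _ Ky yv)).
Qed.

Lemma block_edge B a c : irreflexive e -> block e B -> B a -> B c -> e a c ->
  B = edge_block a c.
Proof.
move=> e_irr [ncB maxB] Ba Bc eac; have [[ncK _] _ _] := edge_blockP e_irr eac.
by rewrite (maxB (edge_block a c)) // => z Bz; exists B.
Qed.

(* A path leaving a block K and returning to it at a different vertex could be
   added to K without creating a cut vertex. *)
Lemma no_ear K k k' p : block e K -> clique e K -> K k -> K k' -> k <> k' ->
  path e k (rcons p k') -> p <> [::] -> (forall z, z \in p -> ~ K z) -> False.
Proof.
move=> [ncK maxK] cK Kk Kk' kk' ep p0 pK.
(* With the edges inside K forbidden, shortening the path to a simple one cannot produce the edge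
   from k to k', so a vertex outside K remains. *)
pose e' := [rel x y | e x y && ~~ (`[< K x >] && `[< K y >])].
have e'p : path e' k (rcons p k').
  case: p p0 pK ep => // x p _ pK /= /andP[-> ep].
  rewrite (asboolF (pK x (mem_head _ _))) andbF /=.
  have xK : ~ K x by apply: pK; rewrite mem_head.
  have {}pK z : z \in p -> ~ K z by move=> zp; apply: pK; rewrite inE zp orbT.
  elim: p x xK pK ep => [|y p IH] x xK pK /= /andP[-> ep].
    by rewrite (asboolF xK).
  rewrite (asboolF xK) /= IH // => [|z zp]; last by apply: pK; rewrite inE zp orbT.
  by apply: pK; rewrite mem_head.
have: last k (rcons p k') = k' by rewrite last_rcons.
case/shortenP: e'p => q e'q uq qp lq.
case/lastP: q e'q uq qp lq => [_ _ _ /kk'//|q y e'q uq qp].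
rewrite last_rcons => yk'; subst y.
have qK z : z \in q -> ~ K z.
  move=> zq; have := qp z; rewrite !mem_rcons !inE zq orbT => /(_ isT).
  case/predU1P=> [zk|/pK//]; move: uq; rewrite /= rcons_uniq -zk zq.
  by rewrite andbF.
have q0 : q <> [::].
  by move=> q0; move: e'q; rewrite q0 /= (asboolT Kk) (asboolT Kk') /= !andbF.
have eq : path e k (rcons q k') by apply: sub_path e'q => u v /= /andP[].
pose S : set V := [set z | K z \/ z \in q].
(* Q is empty or a single deleted vertex, so the claim serves both connectedness and the absence of
   cut vertices. A vertex x of the ear reaches k along p1 or k' along p2, since Q cannot block both
   sides. *)
have claim (Q : set V) x : (forall u v, Q u -> Q v -> u = v) -> S x -> ~ Q x ->
    exists2 w, K w /\ ~ Q w & joined e (S `\` Q) x w.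
  move=> Q1 [Kx|xq] Qx.
    by exists x => //; apply: joined_refl; split=> //; left.
  have [p1 [p2 qE]] : exists p1 p2, q = p1 ++ x :: p2.
    by case: (path.splitPr xq) => p1 p2; exists p1, p2.
  have qS z : z \in q -> S z by right.
  move: eq uq; rewrite qE rcons_cat rcons_cons cat_path /=.
  move=> /andP[ep1 /andP[ep1x ep2]] /andP[kq].
  rewrite cat_uniq /= => /and3P[_ disj _].
  have [[v [Qv vp]]|noQ] := pselect (exists v, Q v /\ v \in k :: p1); last first.
    have Qk : ~ Q k by move=> ?; apply: noQ; exists k; rewrite mem_head.
    exists k => //; apply: joined_sym; exists (rcons p1 x); split.
    - by rewrite rcons_path ep1.
    - by rewrite last_rcons.
    move=> z; rewrite inE mem_rcons inE => /or3P[/eqP->|/eqP->|zp].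
    - by split=> //; left.
    - by split=> //; exact: qS.
    split; first by apply: qS; rewrite qE mem_cat zp.
    by move=> Qz; apply: noQ; exists z; rewrite inE zp orbT.
  have Qp2 z : z \in rcons p2 k' -> ~ Q z.
    move=> zp Qz; have vz := Q1 _ _ Qv Qz; subst z.
    move: vp; rewrite inE => /predU1P[vk|vp1].
      by move: kq; rewrite mem_cat inE -vk zp !orbT.
    by move: disj => /norP[_ /hasP[]]; exists v.
  exists k'; first by split=> //; apply: Qp2; rewrite mem_rcons mem_head.
  exists (rcons p2 k'); split=> //; first by rewrite last_rcons.
  move=> z; rewrite inE => /predU1P[->|zp]; first by split=> //; exact: qS.
  split; last exact: Qp2.
  move: zp; rewrite mem_rcons inE => /predU1P[->|zp]; first by left.
  by apply: qS; rewrite qE mem_cat inE zp !orbT.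
have joinS (Q : set V) x y : (forall u v, Q u -> Q v -> u = v) ->
    S x -> ~ Q x -> S y -> ~ Q y -> joined e (S `\` Q) x y.
  move=> Q1 Sx Qx Sy Qy; have [w [Kw Qw] xw] := claim Q x Q1 Sx Qx.
  have [w' [Kw' Qw'] yw] := claim Q y Q1 Sy Qy.
  apply: joined_trans xw (joined_trans _ (joined_sym yw)).
  have [<-|ww] := pselect (w = w').
    by apply: joined_refl; split=> //; left.
  by apply: joined_edge; [split=> //; left|split=> //; left|exact: cK].
have KS : K `<=` S by move=> z; left.
have ncS : connected_nocut e S.
  split.
    split; first by exists k; left.
    by move=> x y Sx Sy; rewrite -(setD0 S); apply: joinS.
  move=> v [_ [x [y [Sxy xv yv]]]]; apply; apply: joinS => //.
  - by move=> u w -> ->.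
  - by case: Sxy => r [_ _]; apply; rewrite mem_head.
  - by case: Sxy => r [_ <-]; apply; rewrite mem_last.
case: q q0 qK {e'q uq qp eq claim joinS} @S KS ncS => // x q _ qK S KS ncS.
apply: (qK x); first by rewrite mem_head.
by rewrite -(maxK S KS ncS); right; rewrite mem_head.
Qed.
End Joined.

Section BlockGraph.
Variables (V : countType) (e : rel V).
Hypothesis e_sym : symmetric e.
Hypothesis e_irr : irreflexive e.
Hypothesis e_conn : connected_in e setT.

Local Notation d := (gdist e).

Lemma gdist_walk x y : walk e x y (d x y).
Proof.
rewrite /gdist; case: pselect => [xy|[]]; first by case: ex_minnP => k /asboolP.
by have [p [ep lp _]] := e_conn.2 x y I I; exists (size p); apply/asboolP; exists p.
Qed.

Lemma gdist_le x y k : walk e x y k -> d x y <= k.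
Proof.
move=> w; rewrite /gdist; case: pselect => // xy.
by case: ex_minnP => k' _; apply; exact/asboolP.
Qed.

Lemma gdist_path x p : path e x p -> d x (last x p) <= size p.
Proof. by move=> ep; apply: gdist_le; exists p. Qed.

Lemma gdist_eq0 x y : d x y = 0 <-> x = y.
Proof.
split=> [d0|->]; last by apply/eqP; rewrite -leqn0 (gdist_path (p := [::])).
by have [p [_ lp]] := gdist_walk x y; rewrite d0 => /size0nil p0; rewrite -lp p0.
Qed.

Lemma gdist_sym x y : d x y = d y x.
Proof.
suff le u v : d u v <= d v u by apply/eqP; rewrite eqn_leq !le.
move: u v => {}x {}y.
have [p [ep lp <-]] := gdist_walk y x; apply: gdist_le.
exists (rev (belast y p)); split.
- by rewrite -lp rev_path; apply: sub_path ep => u v; rewrite e_sym.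
- by case: p {ep} lp => //= u p _; rewrite rev_cons last_rcons.
- by rewrite size_rev size_belast.
Qed.

Lemma gdist_triangle y x z : d x z <= d x y + d y z.
Proof.
have [p [ep lp <-]] := gdist_walk x y; have [q [eq lq <-]] := gdist_walk y z.
by apply: gdist_le; exists (p ++ q); rewrite cat_path ep lp eq last_cat lp size_cat.
Qed.

Lemma gdist_edge x y : d x y = 1 <-> e x y.
Proof.
split=> [d1|exy].
  have [[|u [|? ?]] []] := gdist_walk x y; rewrite d1 //=.
  by rewrite andbT => exu <-.
apply/eqP; rewrite eqn_leq (gdist_path (p := [:: y])) /= ?exy //.
by rewrite lt0n; apply/eqP => /gdist_eq0 xy; rewrite xy e_irr in exy.
Qed.

Lemma gdist_step x y k : d x y = k.+1 -> exists2 z, d x z = 1 & d z y = k.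
Proof.
move=> dk; have [[|z p] []] := gdist_walk x y; rewrite dk //=.
move=> /andP[exz ep] lp [sp]; have /gdist_edge xz := exz; exists z => //.
have := gdist_path ep; rewrite lp sp => le1.
by have := gdist_triangle z x y; lia.
Qed.

(** * Gates in a block *)

Section Gate.
Variable K : set V.
Hypotheses (bK : block e K) (cK : clique e K).

Lemma gate_ex x : exists k, K k /\ forall z, K z -> d x k <= d x z.
Proof.
have ex : exists i, `[< exists2 k, K k & d x k = i >].
  by have [[[k Kk] _] _] := bK.1; exists (d x k); apply/asboolP; exists k.
case: (ex_minnP ex) => i /asboolP[k Kk ki] imin; exists k; split=> // z Kz.
by rewrite ki; apply: imin; apply/asboolP; exists z.
Qed.

Definition gate x := projT1 (cid (gate_ex x)).

Lemma gateK x : K (gate x).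
Proof. by rewrite /gate; case: cid => k []. Qed.

Lemma gate_min x z : K z -> d x (gate x) <= d x z.
Proof. by rewrite /gate; case: cid => k [_] /= le /le. Qed.

Lemma gate_id x : K x -> gate x = x.
Proof.
move=> Kx; apply/esym/gdist_eq0/eqP; rewrite -leqn0.
by have := gate_min x Kx; rewrite (proj2 (gdist_eq0 x x)).
Qed.

Lemma gate_path x : ~ K x -> exists p,
  [/\ path e x (rcons p (gate x)) & forall z, z \in x :: p -> ~ K z].
Proof.
move=> nKx; have [p [ep lp sp]] := gdist_walk x (gate x).
case/lastP: p ep lp sp => [|p y].
  by move=> _ /= xg; case: nKx; rewrite xg; exact: gateK.
rewrite last_rcons => ep yg; subst y; rewrite size_rcons => sp; exists p; split=> //.
move=> z; rewrite inE => /predU1P[->//|zp] Kz.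
case: (path.splitPr zp) ep sp => p1 p2.
rewrite rcons_cat rcons_cons cat_path size_cat /= => /and3P[ep1 ez _] sp.
have := gdist_path (x := x) (p := rcons p1 z); rewrite rcons_path ep1 ez => /(_ isT).
by rewrite last_rcons size_rcons; have := gate_min x Kz; lia.
Qed.

(** If the gates differed and the edge were not inside K, the edge together with shortest paths to
    the gates would form an ear of K. *)
Lemma gate_edge x y : e x y -> gate x = gate y \/ K x /\ K y.
Proof.
wlog nKy : x y / ~ K y.
  move=> W exy; have [Ky|nKy] := pselect (K y); last exact: W.
  have [Kx|nKx] := pselect (K x); first by right.
  rewrite e_sym in exy; by case: (W y x nKx exy) => [->|[]]; [left|right].
move=> exy; left; apply: contrapT => gxy.
have [p [ep pK]] := gate_path nKy.
have [Kx|nKx] := pselect (K x).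
  rewrite (gate_id Kx) in gxy.
  by apply: (no_ear e_sym bK cK Kx (gateK y) gxy (p := y :: p)); rewrite //= exy.
have [q [eq qK]] := gate_path nKx.
apply: (no_ear e_sym bK cK (gateK x) (gateK y) gxy (p := rcons (rev q) x ++ y :: p)).
- rewrite rcons_cat cat_path rcons_cons /= last_rcons exy ep !andbT.
  have := rev_path e x (rcons q (gate x)); rewrite last_rcons belast_rcons rev_cons.
  by move=> ->; apply: sub_path eq => u v; rewrite e_sym.
- by case: (rev q).
- move=> z; rewrite mem_cat mem_rcons in_cons mem_rev -in_cons.
  by case/orP=> [zq|zp]; [exact: qK|exact: pK].
Qed.

(** By [gate_edge], a path from x to y can change its gate only along an edge inside K. It thus
    passes through [gate x], takes one more step in K, and still has to cover at least the distance
    from y to K. *)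
Lemma gate_dist x y : gate x <> gate y ->
  d x y = d x (gate x) + 1 + d (gate y) y.
Proof.
move=> gxy; have eg : e (gate x) (gate y) by apply: cK => //; exact: gateK.
apply/eqP; rewrite eqn_leq; apply/andP; split.
  have := gdist_triangle (gate x) x y; have := gdist_triangle (gate y) (gate x) y.
  by move/gdist_edge: eg; lia.
have [p [ep lp <-]] := gdist_walk x y; elim: p x gxy ep lp {eg} => [|z p IH] x gxy /=.
  by move=> _ xy; rewrite xy in gxy.
move=> /andP[exz ep] lp.
have [xz|gxz] := pselect (gate x = gate z).
  have := IH z; rewrite -xz => /(_ gxy ep lp).
  have := gdist_triangle z x (gate x); have /gdist_edge := exz; lia.
have [//|[Kx Kz]] := gate_edge exz; rewrite (gate_id Kx).
have := gate_min y Kz; have := gdist_path ep; rewrite lp.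
rewrite (gdist_sym y (gate y)) (gdist_sym y z) (proj2 (gdist_eq0 x x)) //.
by move=> le1 le2; rewrite add1n ltnS (leq_trans le2).
Qed.

Lemma gate_distK x k : K k -> d x k = d x (gate x) + (k != gate x).
Proof.
move=> Kk; have [->|/eqP kg] := eqVneq k (gate x); first by rewrite addn0.
by rewrite gate_dist (gate_id Kk) ?(proj2 (gdist_eq0 k k)) //; [rewrite addn0|move=> /esym].
Qed.
End Gate.

Hypothesis blocks_clique : forall B, block e B -> clique e B.

(** In the block of ac, the distance from a or c to x is the distance from x to its gate, plus 1
    unless the gate is reached; likewise for y. A case distinction on the gates remains. *)
Lemma four_edge a c x y : e a c ->
  [/\ d a c + d x y <= maxn (d a x + d c y) (d a y + d c x),
      d a x + d c y <= maxn (d a c + d x y) (d a y + d c x) &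
      d a y + d c x <= maxn (d a x + d c y) (d a c + d x y)].
Proof.
move=> eac; have [bK Ka Kc] := edge_blockP e_sym e_irr eac.
have cK := blocks_clique bK; pose g := gate bK.
have ac : a <> c by move=> ac; rewrite ac e_irr in eac.
rewrite (proj2 (gdist_edge a c) eac) (gdist_sym a x) (gdist_sym a y).
rewrite (gdist_sym c x) (gdist_sym c y) !(gate_distK bK cK _ Ka).
rewrite !(gate_distK bK cK _ Kc) -/g.
have [gxy|gxy] := pselect (g x = g y).
  have := gdist_triangle (g x) x y; rewrite {2}gxy (gdist_sym (g y)).
  have : (a != g x) + (c != g x) >= 1.
    case: (eqVneq a (g x)) => // ax; case: (eqVneq c (g x)) => // cx.
    by case: ac; rewrite ax cx.
  by rewrite -gxy; split; lia.
rewrite (gate_dist cK gxy) (gdist_sym (gate _ y)) -/(g x) -/(g y).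
case: (eqVneq a (g x)) => ax; case: (eqVneq a (g y)) => ay;
 case: (eqVneq c (g x)) => cx; case: (eqVneq c (g y)) => cy; try (split; lia);
 exfalso; congruence.
Qed.

Lemma gdist_four x y z w :
  d x y + d z w <= maxn (d x z + d y w) (d x w + d y z).
Proof.
(* The three arrangements together say that the two largest sums are equal; the induction along a
   geodesic from a to b needs all of them. *)
suff F k a b u v : d a b = k ->
  [/\ d a b + d u v <= maxn (d a u + d b v) (d a v + d b u),
      d a u + d b v <= maxn (d a b + d u v) (d a v + d b u) &
      d a v + d b u <= maxn (d a u + d b v) (d a b + d u v)].
  by have [] := F _ x y z w erefl.
elim: k a => [|k IH] a dab.
  have ab : a = b by exact/gdist_eq0.
  have := gdist_triangle a u v.
  rewrite -ab (proj2 (gdist_eq0 a a) erefl) (gdist_sym u a).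
  by split; lia.
have [c /gdist_edge eac dcb] := gdist_step dab.
have ac1 : d a c = 1 by exact/gdist_edge.
(* Since c lies between a and b, it lies between a and p or between b and p. *)
have side p : d a p = 1 + d c p \/ d b p = d c b + d c p.
  have := gdist_triangle c a p; have := gdist_triangle c b p.
  have [? ? ?] := four_edge p b eac.
  by have := gdist_sym b p; have := gdist_sym b c; lia.
have [? ? ?] := IH c dcb; have [? ? ?] := four_edge u v eac.
have tri p q : d p q <= d c p + d c q.
  by rewrite (gdist_sym c p); exact: gdist_triangle.
have := tri u v; have := tri a u; have := tri a v; have := tri b u; have := tri b v.
have := gdist_sym c a; have := gdist_sym c b; have := gdist_sym b v.
by case: (side u) (side v) => ? [] ?; split; lia.
Qed.

(** A common neighbour of a and c outside their block would be an ear with one inner vertex. *)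
Lemma edge_blockE a c : e a c -> edge_block e a c = blk d a c.
Proof.
move=> eac; have [bK Ka Kc] := edge_blockP e_sym e_irr eac.
have cK := blocks_clique bK.
have le1 x y : d x y <= 1 <-> x = y \/ e x y.
  split; last by case=> [->|/gdist_edge->//]; rewrite (proj2 (gdist_eq0 y y)).
  case E: (d x y) => [|[|//]] _; first by left; exact/gdist_eq0.
  by right; exact/gdist_edge.
apply/seteqP; split=> z.
  move=> Kz; split; apply/le1.
    by have [->|za] := pselect (z = a); [left|right; exact: cK].
  by have [->|za] := pselect (z = c); [left|right; exact: cK].
move=> [/le1[->//|eza] /le1[->//|ezc]]; apply: contrapT => nKz.
have ac : a <> c by move=> ac; rewrite ac e_irr in eac.
apply: (no_ear e_sym bK cK Ka Kc ac (p := [:: z])) => //=.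
  by rewrite ezc e_sym eza.
by move=> y; rewrite inE => /eqP->.
Qed.
End BlockGraph.

Lemma Tmn_block_metric (V : countType) (e : rel V) m n :
  le_natbar 2 n -> is_Tmn e m n -> block_metric (gdist e) m n.
Proof.
move=> n2 [e_sym e_irr e_conn blkP vP].
have bc B : block e B -> clique e B by move=> /blkP[].
have blkE a c : gdist e a c = 1 -> edge_block e a c = blk (gdist e) a c.
  by move=> /(gdist_edge e_irr e_conn) eac; exact: edge_blockE.
split.
- exact: gdist_eq0.
- exact: gdist_sym.
- exact: gdist_step.
- exact: gdist_four.
- move=> a c ac; rewrite -blkE //.
  by move/(gdist_edge e_irr e_conn): ac => /(edge_blockP e_sym e_irr)[/blkP[]].
- move=> v; have [_] := vP v; congr (has_card _ _).
  apply/seteqP; split=> B /=; last first.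
    move=> [w vw ->]; rewrite -blkE //.
    by move/(gdist_edge e_irr e_conn): vw => /(edge_blockP e_sym e_irr)[].
  move=> [bB Bv]; have [cB cardB] := blkP _ bB.
  (* As n is at least 2, the block has a second vertex w, and is therefore the block of the edge
     vw. *)
  have [w Bw wv] := has_card_ge2 v n2 cardB.
  have evw : e v w by apply: cB => // /esym.
  have vw : gdist e v w = 1 by exact/gdist_edge.
  by exists w => //; rewrite -blkE //; exact: block_edge.
Qed.

(** * Extension of partial isometries *)

Definition isometric (V : choiceType) (d : V -> V -> nat) (r : seq (V * V)) :=
  forall p q, p \in r -> q \in r -> d p.1 q.1 = d p.2 q.2.

(* Twice the Gromov product of x and y at b; the subtraction never truncates,
   by the triangle inequality. *)
Definition gprod (V : Type) (d : V -> V -> nat) (b x y : V) : nat :=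
  d b x + d b y - d x y.

(** In the tree of vertices and blocks, [gprod] is a number of steps from b, even at a vertex and
    odd at a block. Halving identifies a block with its vertex nearest to b. *)
Definition level (h : bool) (k : nat) : nat := if h then k./2 else k.

(** In that tree, the left product tells where the geodesic from b to c meets the one from c to c',
    and the right one how long it runs together with the geodesic from b to a. *)
Definition indep (V : choiceType) (d : V -> V -> nat) (h : bool) (C : seq V)
    (a b : V) : Prop :=
  exists c c', [/\ c \in C, c' \in C &
    level h (gprod d b c c') <= level h (gprod d b a c)].

Section BlockMetric.
Variables (V : choiceType) (d : V -> V -> nat) (m n : natbar).
Hypothesis bm : block_metric d m n.

Ltac quad a b c e :=
  move: (bm_four bm a b c e) (bm_four bm a c b e) (bm_four bm a e b c)
    (bm_sym bm a b) (bm_sym bm a c) (bm_sym bm a e)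
    (bm_sym bm b c) (bm_sym bm b e) (bm_sym bm c e).

Lemma dist_eq x y : d x y = 0 -> x = y.
Proof. by move/(bm_eq0 bm). Qed.

Lemma distxx x : d x x = 0.
Proof. by apply/(bm_eq0 bm). Qed.

Lemma triangle y x z : d x z <= d x y + d y z.
Proof. by quad x z y y; rewrite distxx; lia. Qed.

(** The four-point condition makes the choice unique ([first_step_uniq]). The default c occurs only
    for x = c. *)
Definition first_step c x : V :=
  if pselect (exists z, d c z = 1 /\ (d z x).+1 = d c x) is left ex
  then projT1 (cid ex) else c.

Lemma first_stepP c x : d c x <> 0 ->
  d c (first_step c x) = 1 /\ (d (first_step c x) x).+1 = d c x.
Proof.
case E: (d c x) => [//|k] _; have [z cz zx] := bm_step bm E.
rewrite /first_step E; case: pselect => [ex|[]]; first by case: cid.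
by exists z; rewrite zx.
Qed.

Lemma first_step_uniq c x u : d c u = 1 -> (d u x).+1 = d c x ->
  u = first_step c x.
Proof.
move=> cu ux; have [|cv vx] := @first_stepP c x; first by lia.
by apply: dist_eq; quad u (first_step c x) c x; lia.
Qed.

(** The distance 0, 1 or 2 tells whether x and y are reached from c through the same neighbour, the
    same block or different blocks. Being computed from the distances of c, x and y, it is preserved
    by partial isometries. *)
Lemma first_step_dist c x y : d c x <> 0 -> d c y <> 0 ->
  [/\ d (first_step c x) (first_step c y) <= 2,
      (d (first_step c x) (first_step c y) = 0 <-> d x y + 2 <= d c x + d c y) &
      (d (first_step c x) (first_step c y) <= 1 <-> d x y + 1 <= d c x + d c y)].
Proof.
move=> /first_stepP[cu ux] /first_stepP[cw wy].
set u := first_step c x in cu ux *; set w := first_step c y in cw wy *.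
have uw2 : d u w <= 2 by have := triangle c u w; have := bm_sym bm u c; lia.
have uy : (d u w = 0 -> d u y + 1 = d c y) /\ (d u w > 0 -> d u y + 1 = d u w + d c y).
  split; first by move=> /dist_eq->; lia.
  by quad u w c y; lia.
have xy : (d u w = 0 -> d x y + 2 <= d c x + d c y) /\
          (d u w > 0 -> d x y + 2 = d u w + d c x + d c y).
  split=> uw; first by have := triangle u x y; have := bm_sym bm u x; lia.
  by quad c u x y; lia.
by split; lia.
Qed.

(** This reduces the search for the image of a neighbour of c to its distances from the first
    steps. *)
Lemma dist_nbr c a y : d c a = 1 -> d c y <> 0 ->
  d a y + 1 = d a (first_step c y) + d c y.
Proof.
move=> ca cy; have [cw wy] := first_stepP cy; set w := first_step c y in cw wy *.
have [/dist_eq->|aw] := eqVneq (d a w) 0; first by rewrite distxx; lia.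
by quad a w c y; lia.
Qed.

Lemma nbr_le2 c u w : d c u = 1 -> d c w = 1 -> d u w <= 2.
Proof. by have := triangle c u w; have := bm_sym bm u c; lia. Qed.

Lemma first_step_isometric c x y c' x' y' : d c x <> 0 -> d c y <> 0 ->
    d c x = d c' x' -> d c y = d c' y' -> d x y = d x' y' ->
  d (first_step c x) (first_step c y) = d (first_step c' x') (first_step c' y').
Proof.
move=> cx cy Ex Ey Exy; have [le2 e0 e1] := first_step_dist cx cy.
have [||le2' e0' e1'] := @first_step_dist c' x' y'; lia.
Qed.

Lemma nbr_trans w c u z : d c u = 1 -> d c w = 1 -> d c z = 1 ->
  d u w <= 1 -> d w z <= 1 -> d u z <= 1.
Proof. by move=> *; quad u w z c; lia. Qed.

Lemma blk_eq c u w : d c u = 1 -> d c w = 1 ->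
  blk d c u = blk d c w <-> d u w <= 1.
Proof.
move=> cu cw; split=> [E|uw].
  suff: blk d c w u by case.
  by rewrite -E; split; rewrite ?distxx // (bm_sym bm) cu.
suff sub v v' : d c v = 1 -> d c v' = 1 -> d v v' <= 1 -> blk d c v `<=` blk d c v'.
  by apply/seteqP; split; apply: sub; rewrite // (bm_sym bm).
move=> cv cv' vv' z [zc zv]; split=> //.
have [/dist_eq->|zc0] := eqVneq (d z c) 0; first by rewrite cv'.
by apply: (nbr_trans (w := v) (c := c)) => //; rewrite (bm_sym bm) in zc zc0 *; lia.
Qed.

(** The vertex a is a first step from c towards the domain, or lies in the block of one, or lies in
    a new block. In the last two cases [has_card_avoid] supplies a vertex or block not yet used;
    where there are infinitely many, it can also avoid those leading to B. *)
Lemma ext_step h r c c' a (B : seq V) : isometric d r -> (c, c') \in r -> d c a = 1 ->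
  exists a', [/\ d c' a' = 1, forall p : V * V, p \in r -> d a' p.2 = d a p.1 &
    m = Infty -> (h = false -> n = Infty) ->
    forall b, b \in B -> indep d h (map snd r) a' b].
Proof.
move=> ir cr ca.
have cE (p : V * V) : p \in r -> d c p.1 = d c' p.2 by move=> pr; apply: (ir _ _ cr pr).
suff [a' ca' [da' ia']] : exists2 a', d c' a' = 1 &
    (forall p : V * V, p \in r -> d c p.1 <> 0 ->
       d a' (first_step c' p.2) = d a (first_step c p.1)) /\
    (m = Infty -> (h = false -> n = Infty) ->
       forall b, b \in B -> indep d h (map snd r) a' b).
  exists a'; split=> // p pr; have [cp0|cp] := eqVneq (d c p.1) 0.
    have cp' : d c' p.2 = 0 by rewrite -cE.
    by rewrite -(dist_eq cp0) -(dist_eq cp') (bm_sym bm a') (bm_sym bm a) ca ca'.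
  move/eqP: cp => cp; have cp' : d c' p.2 <> 0 by rewrite -cE.
  by have := dist_nbr ca cp; have := dist_nbr ca' cp'; rewrite da' // cE; lia.
have c'r : c' \in map snd r by apply: (map_f snd cr).
have memr (p : V * V) : p \in r -> p.2 \in map snd r by move=> pr; apply: map_f.
have [[x [xr cx ax]]|no0] :=
    pselect (exists p : V * V, [/\ p \in r, d c p.1 <> 0 & a = first_step c p.1]).
  have cx' : d c' x.2 <> 0 by rewrite -cE.
  have [ca' ax'] := first_stepP cx'; exists (first_step c' x.2) => //; split.
    move=> y yr cy; rewrite ax; apply/esym/first_step_isometric => //; try exact: cE.
    exact: ir.
  (* Here a' lies on the geodesic from c' to [x.2], hence in the hull of the range. *)
  move=> _ _ b _; exists x.2, c'; split=> //; first exact: memr.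
  set a' := first_step _ _ in ca' ax' *.
  suff : gprod d b x.2 c' <= gprod d b a' x.2.
    by rewrite /level; case: h => //; exact: half_leq.
  have := triangle a' b c'; have := bm_sym bm x.2 c'; have := bm_sym bm c' a'.
  by rewrite /gprod; lia.
have no0' (p : V * V) : p \in r -> d c p.1 <> 0 -> d a (first_step c p.1) > 0.
  by move=> pr cp; rewrite lt0n; apply/eqP => /dist_eq E; apply: no0; exists p.
have [[x [xr cx ax]]|no1] :=
    pselect (exists p : V * V, [/\ p \in r, d c p.1 <> 0 & d a (first_step c p.1) = 1]).
  have cx' : d c' x.2 <> 0 by rewrite -cE.
  have [cu ux] := first_stepP cx; have [cu' ux'] := first_stepP cx'.
  set u := first_step c x.1 in ax cu ux; set u' := first_step c' x.2 in cu' ux'.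
  (* The vertices of the block already matched: c itself and the first steps lying in it. *)
  pose P := (c, c') :: [seq (first_step c p.1, first_step c' p.2) | p <- r
               & (d c p.1 != 0) && (d a (first_step c p.1) <= 1)].
  have Pr p : p \in P -> p = (c, c') \/ exists q : V * V, [/\ q \in r, d c q.1 <> 0,
      d a (first_step c q.1) = 1 & p = (first_step c q.1, first_step c' q.2)].
    rewrite inE => /predU1P[->|/mapP[q]]; first by left.
    rewrite mem_filter => /andP[/andP[/eqP cq aq] qr] ->; right.
    by exists q; split=> //; have := no0' q qr cq; lia.
  have cK : has_card (blk d c a) n by apply: (bm_blk bm).
  have cK' : has_card (blk d c' u') n by apply: (bm_blk bm).
  have Ka : blk d c a a by split; rewrite ?distxx // (bm_sym bm) ca.
  pose L := B ++ map (first_step c') B.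
  have [||a' [a'c' a'u'] [a'P a'L]] := has_card_avoid (P := P) L cK cK' Ka.
  - move=> p /Pr[->|[q [qr cq aq ->]]] /=.
      by split; [split; rewrite ?distxx ?ca|move=> E; rewrite -E distxx in ca].
    have [cw wq] := first_stepP cq; split.
      by split; rewrite (bm_sym bm) ?cw // aq.
    by move=> E; rewrite E distxx in aq.
  - move=> p q /Pr[->|[p' [pr cp ap ->]]] /Pr[->|[q' [qr cq aq ->]]] //=.
    + have [cw _] := first_stepP cq.
      have [|cw' _] := @first_stepP c' q'.2; first by rewrite -cE.
      by split=> E; rewrite -E distxx in cw cw'.
    + have [cw _] := first_stepP cp.
      have [|cw' _] := @first_stepP c' p'.2; first by rewrite -cE.
      by split=> E; rewrite E distxx in cw cw'.
    + have := first_step_isometric cp cq (cE _ pr) (cE _ qr) (ir _ _ pr qr).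
      by move=> E; rewrite -!(bm_eq0 bm) E.
  have ca' : d c' a' = 1.
    have := bm_sym bm a' c'; suff: d a' c' <> 0 by lia.
    by move=> /dist_eq E; move: a'P; rewrite /= E inE eqxx.
  exists a' => //; split.
    move=> y yr cy; have cy' : d c' y.2 <> 0 by rewrite -cE.
    have [cw wy] := first_stepP cy; have [cw' wy'] := first_stepP cy'.
    have := first_step_isometric cx cy (cE _ xr) (cE _ yr) (ir _ _ xr yr).
    rewrite -/u -/u'; set w := first_step c y.1 in cw wy *.
    set w' := first_step c' y.2 in cw' wy' * => uw.
    have [aw|aw] := leqP (d a w) 1; last first.
      have := nbr_le2 ca cw; have := nbr_le2 ca' cw'.
      have [a'w'|] := leqP (d a' w') 1; last by lia.
      suff: d a w <= 1 by lia.
      apply: (nbr_trans (w := u) ca cu cw); first by rewrite ax.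
      by rewrite uw; apply: (nbr_trans (w := a') cu' ca' cw'); rewrite // (bm_sym bm).
    have aw1 : d a w = 1 by have := no0' y yr cy; rewrite -/w; lia.
    have le1 : d a' w' <= 1.
      apply: (nbr_trans (w := u') ca' cu' cw'); rewrite // -uw.
      by apply: (nbr_trans (w := a) cu ca cw); rewrite // (bm_sym bm) ax.
    suff: d a' w' <> 0 by lia.
    move=> /dist_eq E; move/negP: a'P; apply; rewrite E; apply/mapP.
    exists (w, w') => //; rewrite inE; apply/orP; right; apply/mapP; exists y => //.
    by rewrite mem_filter yr aw1 andbT /=; apply/andP; split=> //; apply/eqP.
  move=> _ hn b bB.
  have a'x : d a' x.2 = d c' x.2.
    have := dist_nbr ca' cx'; rewrite -/u'.
    suff: d a' u' <> 0 by lia.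
    move=> /dist_eq E; move/negP: a'P; apply; rewrite E; apply/mapP.
    exists (u, u') => //; rewrite inE; apply/orP; right; apply/mapP; exists x => //.
    by rewrite mem_filter xr -/u ax andbT /=; apply/andP; split=> //; apply/eqP.
  have [le|lt] := leqP (d c' b) (d a' b).
    exists x.2, c'; split=> //; first exact: memr.
    suff : gprod d b x.2 c' <= gprod d b a' x.2.
      by rewrite /level; case: (h) => //; exact: half_leq.
    by rewrite /gprod; move: (bm_sym bm x.2 c') (bm_sym bm b c') (bm_sym bm b a'); lia.
  case: h hn => [_|/(_ erefl) ninf]; last first.
    have /norP[_ /negP[]] : ~~ ((a' \in B) || (a' \in map (first_step c') B)).
      by rewrite -mem_cat; exact: a'L.
    apply/mapP; exists b => //; apply: first_step_uniq => //.
    by have := triangle a' c' b; lia.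
  (* Now a' is the first step from c' towards b, and with D the distance from a' to b the two
     products are 2D + 1 and 2D. They agree after halving. *)
  exists c', x.2; split=> //; first exact: memr.
  have := triangle a' c' b; rewrite /level /gprod; quad a' c' b x.2; lia.
have no1' (p : V * V) : p \in r -> d c p.1 <> 0 -> d a (first_step c p.1) = 2.
  move=> pr cp; have [cw _] := first_stepP cp; have := nbr_le2 ca cw.
  have := no0' p pr cp; suff: d a (first_step c p.1) <> 1 by lia.
  by move=> E; apply: no1; exists p.
(* In the last case whole blocks are matched instead of vertices. *)
pose P := [seq (blk d c (first_step c p.1), blk d c' (first_step c' p.2)) | p <- r
               & d c p.1 != 0].
have Pr p : p \in P -> exists q : V * V, [/\ q \in r, d c q.1 <> 0 &
    p = (blk d c (first_step c q.1), blk d c' (first_step c' q.2))].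
  by move=> /mapP[q]; rewrite mem_filter => /andP[/eqP cq qr] ->; exists q.
pose L := [seq blk d c' (first_step c' b) | b <- B].
have Ka : blocks_at d c (blk d c a) by exists a.
have [||K' [a' ca' ->] [a'P a'L]] :=
  has_card_avoid (P := P) L (bm_deg bm c) (bm_deg bm c') Ka.
- move=> p /Pr[q [qr cq ->]] /=; have [cw wq] := first_stepP cq; split.
    by exists (first_step c q.1).
  by move=> /(blk_eq cw ca); rewrite (bm_sym bm) no1'.
- move=> p q /Pr[p' [pr cp ->]] /Pr[q' [qr cq ->]] /=.
  have [cw _] := first_stepP cp; have [cv _] := first_stepP cq.
  have [|cw' _] := @first_stepP c' p'.2; first by rewrite -cE.
  have [|cv' _] := @first_stepP c' q'.2; first by rewrite -cE.
  rewrite (blk_eq cw cv) (blk_eq cw' cv').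
  by rewrite (first_step_isometric cp cq (cE _ pr) (cE _ qr) (ir _ _ pr qr)).
exists a' => //; split.
  move=> y yr cy; have cy' : d c' y.2 <> 0 by rewrite -cE.
  have [cw' wy'] := first_stepP cy'; rewrite (no1' _ yr cy).
  have := nbr_le2 ca' cw'; have [le1|] := leqP (d a' (first_step c' y.2)) 1; last by lia.
  move: a'P; rewrite (proj2 (blk_eq ca' cw') le1) => /negP[]; apply/mapP.
  exists (blk d c (first_step c y.1), blk d c' (first_step c' y.2)) => //.
  by apply/mapP; exists y; rewrite // mem_filter yr andbT; apply/eqP.
(* The block of a' contains no first step towards b, so the geodesic from a' to b passes through
   c'. *)
move=> minf _ b bB; exists c', c'; split=> //.
suff : gprod d b c' c' <= gprod d b a' c'.
  by rewrite /level; case: h => //; exact: half_leq.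
have [/dist_eq bc|/eqP bc] := eqVneq (d c' b) 0.
  by rewrite /gprod bc distxx; lia.
have [cw wb] := first_stepP bc; have := dist_nbr ca' bc.
suff : d a' (first_step c' b) > 1.
  rewrite /gprod distxx; move: (bm_sym bm b c') (bm_sym bm b a') (bm_sym bm c' a'); lia.
rewrite ltnNge; apply/negP => le1; move: (a'L minf).
rewrite (proj2 (blk_eq ca' cw) le1) => /negP; apply.
by apply/mapP; exists b.
Qed.

(** * Gromov products and independence of points *)

Lemma gprodC b x y : gprod d b x y = gprod d b y x.
Proof. by rewrite /gprod addnC (bm_sym bm x). Qed.

Lemma level_mono h : {homo level h : i j / i <= j}.
Proof. by case: h => i j //; exact: half_leq. Qed.

(* The four-point condition says that the Gromov product is an ultrametric. *)
Lemma gprod_ultra h b y x z :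
  minn (level h (gprod d b x y)) (level h (gprod d b y z)) <= level h (gprod d b x z).
Proof.
have: minn (gprod d b x y) (gprod d b y z) <= gprod d b x z.
  have := triangle b x y; have := triangle b y z; have := triangle b x z.
  by rewrite /gprod; quad b x y z; lia.
by rewrite !geq_min => /orP[] /(@level_mono h) ->; rewrite ?orbT.
Qed.

Lemma indep_self h (C : seq V) c b : c \in C -> indep d h C c b.
Proof. by move=> cC; exists c, c. Qed.

Lemma indep_sub h (C D : seq V) a b : {subset C <= D} ->
  indep d h C a b -> indep d h D a b.
Proof. by move=> CD [c [c' [/CD cD /CD c'D le]]]; exists c, c'. Qed.

(** Let p be the point where geodesics from b enter the hull of C. The points whose geodesic to b
    passes through p form a convex set containing D, so a geodesic from b meeting the hull of D also
    passes through p. The proof uses only the ultrametric inequality, so it covers both values of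
    h. *)
Lemma indep_trans h (C D : seq V) a b : (forall t, t \in D -> indep d h C t b) ->
  indep d h D a b -> indep d h C a b.
Proof.
move=> CD [t [t' [tD t'D le]]].
have [c [e [cC eC ce]]] := CD t tD; have [c' [e' [c'C e'C ce']]] := CD t' t'D.
pose G x y := level h (gprod d b x y).
have U y x z : minn (G x y) (G y z) <= G x z by apply: gprod_ultra.
have GC x y : G x y = G y x by rewrite /G gprodC.
rewrite -!/(G _ _) in le ce ce'.
have out x y : x \in C -> y \in C -> G x y <= G a x -> indep d h C a b.
  by move=> xC yC; exists x, y.
have [h1|h1] := leqP (G c e) (G a c); first exact: (out c e).
have [h2|h2] := leqP (G c c') (G a c); first exact: (out c c').
have [h3|h3] := leqP (G c e') (G a c); first exact: (out c e').
have := U t a c; have := U c t t'; have := U c' c t'; have := U c c' e'.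
have := GC t c; have := GC t' c'; have := GC c' c.
by lia.
Qed.

(** Without rounding, the inequality reads d a c + d b c' <= d a b + d c c', which is symmetric
    under exchanging a with b and c with c'. *)
Lemma indep_sym h (C : seq V) a b : indep d h C a b -> indep d h C b a.
Proof.
move=> [c [c' [cC c'C le]]]; exists c', c; split=> //; move: le.
have := triangle b a c; have := triangle b c c'; have := triangle a c c'.
have := triangle a b c'; rewrite /gprod /level.
by case: h; quad a b c c'; lia.
Qed.

Lemma isometric_cons r a a' : isometric d r ->
  (forall p : V * V, p \in r -> d a' p.2 = d a p.1) -> isometric d ((a, a') :: r).
Proof.
move=> ir E p q; rewrite !inE => /predU1P[->|pr] /predU1P[->|qr] /=.
- by rewrite !distxx.
- by rewrite E.
- by rewrite (bm_sym bm) (bm_sym bm p.2) E.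
- exact: ir.
Qed.

(** The point a is reached from c one edge at a time, and [indep_trans] eliminates the intermediate
    points. *)
Lemma ext_indep h r c a (B : seq V) : isometric d r -> c \in r ->
  exists a', isometric d ((a, a') :: r) /\
    (m = Infty -> (h = false -> n = Infty) -> forall C : seq V,
     (forall (p : V * V) b, p \in r -> b \in B -> indep d h C p.2 b) ->
     forall b, b \in B -> indep d h C a' b).
Proof.
case: c => c c' ir cr; move E: (d a c) => k; elim: k a E => [|k IH] a ac.
  rewrite (dist_eq ac); exists c'; split; last first.
    by move=> _ _ C hC b bB; exact: (hC (c, c')).
  by apply: isometric_cons => // p pr; rewrite -(ir (c, c') p).
have [z az zc] := bm_step bm ac; have [z' [iz hz]] := IH z zc.
have [|||a' [_ a'E ha]] := @ext_step h ((z, z') :: r) z z' a B => //.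
- by rewrite mem_head.
- by rewrite (bm_sym bm).
exists a'; split.
  by apply: isometric_cons => // p pr; apply: a'E; rewrite inE pr orbT.
move=> minf hn C hC b bB; apply: indep_trans (ha minf hn b bB) => t /mapP[p].
by rewrite inE => /predU1P[->|pr] ->; [exact: hz|exact: hC].
Qed.

(** * Homogeneity: types are determined by distances *)

Lemma ext_point r a : isometric d r -> exists a', isometric d ((a, a') :: r).
Proof.
case: r => [|c r] ir; last first.
  have [|a' []] := @ext_indep false (c :: r) c a [::] ir; first by rewrite mem_head.
  by exists a'.
by exists a; apply: isometric_cons.
Qed.

(* Back-and-forth: the quantifier step is [ext_point], applied to r or its inverse. *)
Lemma sat_isometric (X : Type) (phi : formula X) (s s' : X -> V) r :
  isometric d r -> (forall x, (s x, s' x) \in r) -> sat d phi s <-> sat d phi s'.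
Proof.
elim: phi s s' r => {X} [X x y|X k x y|X|X f IHf g IHg|X f IHf] s s' r ir sr /=.
- by rewrite -!(bm_eq0 bm) (ir _ _ (sr x) (sr y)).
- by rewrite (ir _ _ (sr x) (sr y)).
- by [].
- by rewrite (IHf s s' r) // (IHg s s' r).
split=> H a.
  pose r' := [seq (p.2, p.1) | p <- r].
  have [|a' ia] := @ext_point r' a.
    by move=> p q /mapP[p' pr ->] /mapP[q' qr ->] /=; rewrite (ir _ _ pr qr).
  apply: (proj1 (IHf (fun u => oapp s a' u) _ ((a', a) :: r) _ _) (H a')).
  - move=> p q; rewrite !inE => pr qr.
    have := ia (p.2, p.1) (q.2, q.1); rewrite !inE /= => ->//.
    + case/predU1P: pr => [->|pr]; rewrite ?eqxx //; apply/orP; right.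
      by apply/mapP; exists p.
    + case/predU1P: qr => [->|qr]; rewrite ?eqxx //; apply/orP; right.
      by apply/mapP; exists q.
  - by case=> [x|] /=; rewrite inE ?eqxx // sr orbT.
have [a' ia] := ext_point a ir.
apply: (proj2 (IHf _ (fun u => oapp s' a' u) ((a, a') :: r) ia _) (H a')).
by case=> [x|] /=; rewrite inE ?eqxx // sr orbT.
Qed.

Lemma tp_isometric k (a a' : k.-tuple V) (C : {fset V}) r : isometric d r ->
    (forall i, (tnth a i, tnth a' i) \in r) -> (forall c, c \in C -> (c, c) \in r) ->
  tp d a C = tp d a' C.
Proof.
move=> ir ar Cr.
have sr (u : 'I_k + C) : (match u with inl i => tnth a i | inr c => val c end,
    match u with inl i => tnth a' i | inr c => val c end) \in r.
  by case: u => [i|c]; [exact: ar|apply: Cr; exact: valP].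
by apply/seteqP; split=> phi /=; [apply: (proj1 _)|apply: (proj2 _)];
  apply: (sat_isometric _ ir sr).
Qed.

Lemma tp_eq_dist k (a a' : k.-tuple V) (C : {fset V}) :
    (forall i j, d (tnth a i) (tnth a j) = d (tnth a' i) (tnth a' j)) ->
    (forall i c, c \in C -> d (tnth a i) c = d (tnth a' i) c) ->
  tp d a C = tp d a' C.
Proof.
move=> aa aC; pose r := [seq (tnth a i, tnth a' i) | i <- enum 'I_k]
                     ++ [seq (c, c) | c <- enum_fset C].
apply: (@tp_isometric _ _ _ _ r).
- move=> p q; rewrite !mem_cat => /orP[] /mapP[x xr ->] /orP[] /mapP[y yr ->] //=.
  + exact: aC.
  + by rewrite (bm_sym bm) (bm_sym bm x) aC.
- by move=> i; rewrite mem_cat (map_f (fun i => (tnth a i, tnth a' i))) ?mem_enum.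
- by move=> c cC; rewrite mem_cat (map_f (fun c => (c, c))) ?orbT.
Qed.

Lemma tp_dist k (a a' : k.-tuple V) (C : {fset V}) : tp d a C = tp d a' C ->
  (forall i j, d (tnth a i) (tnth a j) = d (tnth a' i) (tnth a' j)) /\
  (forall i c, c \in C -> d (tnth a i) c = d (tnth a' i) c).
Proof.
move=> E; split=> [i j|i c cC].
  have : tp d a C (Dist (d (tnth a i) (tnth a j)) (inl i) (inl j)) by [].
  by rewrite E.
have : tp d a C (Dist (d (tnth a i) c) (inl i) (inr [` cC]%fset)) by [].
by rewrite E.
Qed.
(** * Independence relations *)

Lemma elems_enum (C : {fset V}) : elems (in_tuple (enum_fset C)) = C.
Proof. by apply/fsetP => x; rewrite !inE. Qed.

Lemma elems1 (b : V) : elems [tuple b] = [fset b]%fset.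
Proof. by apply/fsetP => x; rewrite !inE orbF. Qed.

Lemma isometric_diag (C : seq V) : isometric d [seq (c, c) | c <- C].
Proof. by move=> p q /mapP[x _ ->] /mapP[y _ ->]. Qed.

(* By homogeneity and invariance, two points with the same type over C can be
   exchanged, so stationarity forces any point independent from both to be
   equidistant from them. *)
Lemma SIR_equidistant base ind (C : {fset V}) a (B : seq V) :
    SIR_over d base ind -> base C ->
  exists a', (forall c, c \in C -> d a' c = d a c) /\
    (forall b1 b2, b1 \in B -> b2 \in B ->
       (forall c, c \in C -> d b1 c = d b2 c) -> d a' b1 = d a' b2).
Proof.
move=> S bC.
have [t [tE tB]] := SIR_existence S [tuple a] [fset x in B]%fset bC.
have [a' ta] : exists a', t = [tuple a'].
  by case: (t) => -[|a' [|? ?]] // st; exists a'; exact: val_inj.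
rewrite {}ta {t} in tE tB.
exists a'; split.
  by move=> c cC; have [_ /(_ ord0 c cC)] := tp_dist tE.
move=> b1 b2 b1B b2B b12.
have indB b : b \in B -> ind (elems [tuple a']) C (elems [tuple b]).
  move=> bB; suff BE : ([fset b] `|` [fset x in B] = [fset x in B])%fset.
    by rewrite -BE in tB; have [] := SIR_monotonicity S bC tB; rewrite (elems1 b).
  by apply/fsetP => x; rewrite !inE; case: eqVneq => // ->.
pose r := (b2, b1) :: [seq (c, c) | c <- enum_fset C].
have ir : isometric d r.
  apply: isometric_cons; first exact: isometric_diag.
  by move=> p /mapP[c cC ->] /=; exact: b12.
(* The isometry fixes C and moves b2 to b1, so a'' is independent from b1 and has the type of a'
   over C. *)
have [a'' ia] := ext_point a' ir.
have a''E p : p \in r -> d a' p.1 = d a'' p.2.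
  by move=> pr; apply: (ia (a', a'')); rewrite ?mem_head // in_cons pr orbT.
have rC c : c \in C -> (c, c) \in r.
  by move=> cC; rewrite inE (map_f (fun c => (c, c))) ?orbT.
have ind' : ind (elems [tuple a'']) C (elems [tuple b1]).
  have := SIR_invariance S (a := [tuple a']) (b := [tuple b2])
    (c := in_tuple (enum_fset C)) (a' := [tuple a'']) (b' := [tuple b1])
    (c' := in_tuple (enum_fset C)); rewrite elems_enum; apply=> //; last exact: indB.
  apply: (tp_isometric ia) => // -[[|[|i]] ilt]; rewrite !(tnth_nth a') in_cons /=.
  - by rewrite eqxx.
  - by rewrite mem_head orbT.
  by apply/orP; right; apply: rC; apply: mem_nth.
have /tp_dist[_ /(_ ord0 b1)] : tp d [tuple a'] ([fset b1] `|` C)%fset =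
    tp d [tuple a''] ([fset b1] `|` C)%fset.
  rewrite -(elems1 b1); apply: (SIR_stationarity S bC) => //; last exact: indB.
  apply: tp_eq_dist => [i j|i c cC]; first by rewrite !ord1 /= !(tnth_nth a') /= !distxx.
  by rewrite ord1 !(tnth_nth a') /=; exact: (a''E (c, c) (rC c cC)).
rewrite !inE eqxx !(tnth_nth a') /= => -> //.
by rewrite (a''E (b2, b1)) ?mem_head.
Qed.

(** * Nonexistence *)

Lemma nbr_ex c : le_natbar 2 m -> forall K, exists w, d c w = 1 /\ blk d c w <> K.
Proof.
by move=> m2 K; have [_ [w cw ->] wK] := has_card_ge2 K m2 (bm_deg bm c); exists w.
Qed.

Lemma no_SIR (v : V) : le_natbar 2 m -> ~ has_SIR d.
Proof.
move=> m2 [ind S]; have [b1 [v1 _]] := nbr_ex v m2 set0.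
have [b2 [v2 b12]] := nbr_ex v m2 (blk d v b1).
have [a [_ eqd]] := @SIR_equidistant _ _ fset0 v [:: b1; v; b2] S I.
have E1 := eqd b1 v; have E2 := eqd b2 v; rewrite !inE !eqxx !orbT /= in E1 E2.
have {}E1 : d a b1 = d a v by apply: E1.
have {}E2 : d a b2 = d a v by apply: E2.
have : d b1 b2 = 2.
  have := nbr_le2 v1 v2; have [le1|] := leqP (d b1 b2) 1; last by lia.
  by case: b12; apply/blk_eq; rewrite // (bm_sym bm).
(* With k = d a v, the sum d a v + d b1 b2 is k + 2, while the other two are k + 1. *)
by quad a v b1 b2; lia.
Qed.

Lemma local_SIR_m (v : V) : le_natbar 2 m -> has_local_SIR d -> m = Infty.
Proof.
move=> m2 [ind S]; have deg := bm_deg bm v; have nex := nbr_ex v m2.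
case: m deg m2 nex => [k|//] deg m2 nex; exfalso.
have [s [us sk sP]] := has_card_seq deg.
pose pick K := if pselect (exists2 w, d v w = 1 & K = blk d v w) is left ex
  then s2val (cid2 ex) else v.
have pickP K : blocks_at d v K -> d v (pick K) = 1 /\ K = blk d v (pick K).
  by rewrite /pick; case: pselect => // ex _; case: cid2.
have [b [vb _]] := nex set0.
have vN : [fset v]%fset <> fset0 :> {fset V}.
  by move=> /fsetP/(_ v); rewrite !inE eqxx.
have [a [aC eqd]] := @SIR_equidistant _ _ [fset v]%fset b (map pick s) S vN.
have va : d v a = 1 by rewrite (bm_sym bm) aC ?inE // (bm_sym bm).
have [w [vw wa]] := nex (blk d v a).
have Ka : blocks_at d v (blk d v a) by exists a.
have Kw : blocks_at d v (blk d v w) by exists w.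
have [v1 E1] := pickP _ Ka; have [v2 E2] := pickP _ Kw.
(* The representative of the block of a is at distance at most 1 from a, the one of another block at
   distance 2. *)
have : d a (pick (blk d v a)) = d a (pick (blk d v w)).
  apply: eqd; try by apply: map_f; apply/sP.
  by move=> c; rewrite inE => /eqP->; rewrite (bm_sym bm) v1 (bm_sym bm) v2.
have := proj1 (blk_eq va v1) E1 => le1 E; apply: wa; rewrite E2.
by apply/blk_eq; rewrite // (bm_sym bm) -E.
Qed.

Lemma uniq_notin (s t : seq V) : uniq s -> size t < size s ->
  exists2 x, x \in s & x \notin t.
Proof.
move=> us lt; apply: contrapT => no; suff: size s <= size t by lia.
apply: uniq_leq_size us _ => x xs; apply: contrapT => /negP xt.
by apply: no; exists x.
Qed.

Lemma local_SIR_n (v : V) : le_natbar 2 m -> le_natbar 2 n ->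
  has_local_SIR d -> n = Fin 2 \/ n = Fin 3 \/ n = Infty.
Proof.
move=> m2 n2 [ind S]; have [w [vw _]] := nbr_ex v m2 set0.
have := bm_blk bm vw; case: n n2 => [[|[|[|[|k]]]]|] //=; try by tauto.
move=> _ /has_card_seq[s [us sk sP]]; exfalso.
have nbr x : x \in s -> x \notin [:: v; w] -> d x v = 1 /\ d x w = 1.
  move=> /sP[xv xw]; rewrite !inE => /norP[xv0 xw0]; split.
    suff: d x v <> 0 by lia.
    by move=> /dist_eq E; rewrite E eqxx in xv0.
  suff: d x w <> 0 by lia.
  by move=> /dist_eq E; rewrite E eqxx in xw0.
have [|x xs xvw] := @uniq_notin s [:: v; w] us; first by rewrite sk.
have vN : [fset v; w]%fset <> fset0 :> {fset V}.
  by move=> /fsetP/(_ v); rewrite !inE eqxx.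
have [a [aC eqd]] := @SIR_equidistant _ _ [fset v; w]%fset x s S vN.
have [xv xw] := nbr _ xs xvw.
have av : d a v = 1 by rewrite aC ?inE ?eqxx.
have aw : d a w = 1 by rewrite aC ?inE ?eqxx ?orbT.
have as_ : a \in s by apply/sP; split; rewrite ?av ?aw.
have [|y ys yn] := @uniq_notin s [:: a; v; w] us; first by rewrite sk.
move: yn; rewrite inE => /norP[/eqP ya yvw]; have [yv yw] := nbr _ ys yvw.
(* The point a is itself in the list, at distance 0 from itself, so y would equal a. *)
have := eqd a y as_ ys; rewrite distxx => E; apply: ya; apply/esym/dist_eq/esym/E.
by move=> c; rewrite !inE => /orP[] /eqP->; rewrite ?av ?aw ?yv ?yw.
Qed.

(** * Existence of a local independence relation *)

Lemma geodesic_point c c' i j : d c c' = i + j ->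
  exists u, d c u = i /\ d u c' = j.
Proof.
elim: i c => [|i IH] c E; first by exists c; rewrite distxx.
have [z cz zc] := bm_step bm E; have [u [zu uc]] := IH z zc.
by exists u; split=> //; have := triangle z c u; have := triangle u c c'; lia.
Qed.

(* If a and b both branch off the geodesic from c to c' in the middle of the same
   block, then in a triangle they branch off at its unique third vertex. *)
Lemma third_vertex k a b c c' : n = Fin k -> k <= 3 ->
    d a c + d b c' = d a c' + d b c -> odd (d b c + d b c' + d c c') ->
  d a b + d c c' < d a c + d b c'.
Proof.
move=> nk k3 Y bodd.
have := triangle a c c'; have := triangle c a c'; have := triangle c' a c.
have := bm_sym bm c a; have := bm_sym bm c' c => s1 s2 t1 t2 t3.
(* The doubled Gromov product of a and c' at c is odd, namely 2i + 1: the branching takes place in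
   the block of u and w, at distances i and i + 1 from c. *)
pose i := (d c c' + d a c - d a c' - 1)./2.
have [u [cu uc']] := @geodesic_point c c' i (d c c' - i) ltac:(rewrite /i; lia).
have uc'0 : d u c' <> 0 by rewrite uc' /i; lia.
have [uw wc'] := first_stepP uc'0; set w := first_step u c' in uw wc'.
have cw : d c w = i.+1.
  by have := triangle u c w; have := triangle w c c'; lia.
have far x : d x c + d c c' = d x c' + 2 * i + 1 -> d x u = d x w /\ d x u = d x c - i.
  have := triangle x c c'; have := bm_sym bm c x.
  by quad x u c c'; quad x w c c'; lia.
have [au aE] := far a ltac:(rewrite /i; lia).
have [bu bE] := far b ltac:(rewrite /i; lia).
(* The first step from u towards x is the vertex of this block at which x branches off. *)
have branch x : d x u = d x w -> exists z, [/\ d u z = 1, d w z = 1 & d z x + 1 = d x u].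
  move=> xuw; have ux0 : d u x <> 0.
    by rewrite (bm_sym bm) => x0; move: xuw; rewrite x0 (dist_eq x0) (uw : d u w = 1).
  have [uz zx] := first_stepP ux0; exists (first_step u x); split=> //; last first.
    by have := bm_sym bm u x; lia.
  by have := dist_nbr uw ux0; have := bm_sym bm w x; have := bm_sym bm u x; lia.
have [y [uy wy ya]] := branch a au; have [z [uz wz zb]] := branch b bu.
have yz : y = z.
  apply: contrapT => yz; have := bm_blk bm uw; rewrite nk => /has_card_seq[s [us sk sP]].
  have neq p q : d p q = 1 -> p != q.
    by move=> pq; apply/eqP => E; rewrite E distxx in pq.
  have: 4 <= k.
    rewrite -sk; apply: (@uniq_leq_size _ [:: u; w; y; z]).
      rewrite /= !inE !negb_or (neq _ _ uw) (neq _ _ uy) (neq _ _ uz) (neq _ _ wy).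
      by rewrite (neq _ _ wz) /= andbT; exact/eqP.
    have sym1 p q : d p q = 1 -> d q p = 1 by rewrite (bm_sym bm).
    move: (sym1 _ _ uw) (sym1 _ _ uy) (sym1 _ _ uz) (sym1 _ _ wy) (sym1 _ _ wz).
    move=> wu yu zu yw zw x; rewrite !inE => /or4P[] /eqP->; apply/sP;
    by split; rewrite ?distxx ?uw ?wu ?yu ?yw ?zu ?zw.
  by lia.
(* Both a and b reach the block at y, so going through y avoids the step between u and w. *)
have := triangle y a b; rewrite {2}yz; have := bm_sym bm a y.
have := triangle b c c'; have := bm_sym bm c b.
move: aE bE; rewrite /i; lia.
Qed.

(** Without rounding, independence makes d a b + d c c' the largest of the three sums for a, b, c,
    c'. For a' the four-point condition bounds this sum by the other two, which are the same as for
    a. Rounding could lose 1 only when the product of c and c' at b is odd, and [third_vertex] then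
    regains it. *)
Lemma indep_dist_le h (C : seq V) a a' b :
    (h = true -> exists2 k, n = Fin k & k <= 3) ->
    (forall c, c \in C -> d a c = d a' c) -> indep d h C a b -> d a' b <= d a b.
Proof.
move=> hn aa [c [c' [cC c'C]]].
have := triangle b c c'; have := triangle b a c; have := bm_sym bm c b.
rewrite /gprod /level; have Ec := aa _ cC; have Ec' := aa _ c'C.
case: h hn => [/(_ erefl)[k nk k3]|_].
  have := @third_vertex k a' b c c' nk k3.
  have := bm_sym bm b a; have := bm_sym bm b a'; have := bm_sym bm b c.
  by quad a b c c'; quad a' b c c'; lia.
by quad a b c c'; quad a' b c c'; lia.
Qed.

Lemma tp_zip_isometric k (s s' : k.-tuple V) C : tp d s C = tp d s' C ->
  isometric d (zip s s').
Proof.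
move=> /tp_dist[E _].
have tn p : p \in zip s s' -> exists i, p = (tnth s i, tnth s' i).
  have ss : size s = size s' by rewrite !size_tuple.
  move=> /(nthP p)[i]; rewrite size_zip ss minnn size_tuple => ik.
  rewrite (set_nth_default (p.1, p.2)) ?size_zip ?ss ?minnn ?size_tuple //.
  rewrite nth_zip // => <-; exists (Ordinal ik).
  by rewrite (tnth_nth p.1) (tnth_nth p.2).
by move=> p q /tn[i ->] /tn[j ->] /=; exact: E.
Qed.

Lemma local_SIR (h : bool) : m = Infty -> (h = false -> n = Infty) ->
  (h = true -> exists2 k, n = Fin k & k <= 3) -> has_local_SIR d.
Proof.
move=> minf h0 h1.
exists (fun A C B : {fset V} => forall a b, a \in A -> b \in B ->
   indep d h (enum_fset C) a b); split.
- move=> ka kb kc a a' b b' c c' _ _ /tp_zip_isometric.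
  rewrite /= !zip_cat ?size_tuple // => ir H x y; rewrite !in_fset => xa yb.
  have back k (s s' : k.-tuple V) z : z \in tval s' ->
      exists2 z', z' \in tval s & (z', z) \in zip s s'.
    move=> /(nthP z)[i]; rewrite size_tuple => ik <-.
    exists (nth z s i); first by rewrite mem_nth // size_tuple.
    by rewrite -nth_zip ?size_tuple // mem_nth // size_zip !size_tuple minnn.
  have forth k (s s' : k.-tuple V) z : z \in tval s ->
      exists2 z', z' \in tval s' & (z, z') \in zip s s'.
    move=> /(nthP z)[i]; rewrite size_tuple => ik <-.
    exists (nth z s' i); first by rewrite mem_nth // size_tuple.
    by rewrite -nth_zip ?size_tuple // mem_nth // size_zip !size_tuple minnn.
  have [x' x'a xz] := back _ a _ _ xa; have [y' y'b yz] := back _ b _ _ yb.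
  have [||z [t [zc tc]]] := H x' y'; rewrite ?in_fset //.
  rewrite !in_fset in zc tc.
  have [z' z'c zz] := forth _ _ c' _ zc; have [t' t'c tz] := forth _ _ c' _ tc.
  rewrite /gprod => le; exists z', t'; split; rewrite ?in_fset //.
  rewrite /gprod.
  have E p q : p \in zip a a' ++ zip b b' ++ zip c c' ->
      q \in zip a a' ++ zip b b' ++ zip c c' -> d p.2 q.2 = d p.1 q.1.
    by move=> pr qr; rewrite (ir p q).
  have xr : (x', x) \in zip a a' ++ zip b b' ++ zip c c' by rewrite mem_cat xz.
  have yr : (y', y) \in zip a a' ++ zip b b' ++ zip c c' by rewrite !mem_cat yz orbT.
  have zr : (z, z') \in zip a a' ++ zip b b' ++ zip c c' by rewrite !mem_cat zz !orbT.
  have tr : (t, t') \in zip a a' ++ zip b b' ++ zip c c' by rewrite !mem_cat tz !orbT.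
  have /= -> := E _ _ yr zr; have /= -> := E _ _ yr tr; have /= -> := E _ _ zr tr.
  by have /= -> := E _ _ yr xr; have /= -> := E _ _ xr zr.
- by move=> A B C _ H b a bB aA; apply: indep_sym; exact: H.
- move=> A B C D _ H; split=> a b aA bB; first by apply: H => //; rewrite inE bB.
  apply: (indep_sub (C := enum_fset C)); last by apply: H => //; rewrite inE bB orbT.
  by move=> c cC; rewrite inE cC orbT.
- move=> k a B C C0.
  have [c cC] : exists c, c \in C by apply/fset0Pn/eqP.
  (* The identity of C is extended by one entry of the tuple at a time, each new point being
     independent from B over C. *)
  have [s' [ss ir indep_s]] : exists s' : seq V, [/\ size s' = size a,
      isometric d (zip a s' ++ [seq (x, x) | x <- enum_fset C]) &
      forall x b, x \in s' -> b \in B -> indep d h (enum_fset C) x b].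
    elim: (tval a) => [|x s [s' [ss ir is']]].
      by exists [::]; split=> //; exact: isometric_diag.
    have cr : (c, c) \in zip s s' ++ [seq (x, x) | x <- enum_fset C].
      by rewrite mem_cat (map_f (fun x => (x, x))) ?orbT.
    have [x' [ix hx]] := @ext_indep h _ _ x (enum_fset B) ir cr.
    exists (x' :: s'); split=> //=; first by rewrite ss.
    have {}hx := hx minf h0 (enum_fset C).
    move=> y b; rewrite inE => /predU1P[->|ys] bB; last exact: is'.
    apply: hx bB => p b'; rewrite mem_cat => /orP[ps|/mapP[z zC ->]] bB.
      by apply: is' => //; have := map_f snd ps; rewrite -/unzip2 unzip2_zip // ss.
    exact: indep_self.
  have st : size s' == k by rewrite ss size_tuple.
  exists (Tuple st); split; last by move=> x b; rewrite in_fset; exact: indep_s.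
  apply/esym/(tp_isometric ir).
    move=> i; rewrite mem_cat; apply/orP; left.
    by rewrite !(tnth_nth c) -nth_zip ?ss // mem_nth // size_zip ss minnn size_tuple.
  by move=> x xC; rewrite mem_cat (map_f (fun x => (x, x))) ?orbT.
- move=> k a a' B C _ /tp_dist[aa aC] Ha Ha'; apply: tp_eq_dist => // i x.
  (* Both tuples are independent from x, so [indep_dist_le] applies in both directions. *)
  rewrite inE => /orP[xB|/aC//]; apply/eqP; rewrite eqn_leq.
  apply/andP; split.
    apply: (@indep_dist_le h (enum_fset C)) => //; first by move=> c cC; rewrite aC.
    by apply: Ha' => //; rewrite in_fset mem_tnth.
  apply: (@indep_dist_le h (enum_fset C)) => //; first by move=> c cC; rewrite aC.
  by apply: Ha => //; rewrite in_fset mem_tnth.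
Qed.
End BlockMetric.

Theorem theorem8p10 (m n : natbar) (V : countType) (e : rel V) :
  le_natbar 2 m -> le_natbar 2 n -> is_Tmn e m n ->
  ~ has_SIR (gdist e) /\
  (has_local_SIR (gdist e) <->
   m = Infty /\ (n = Fin 2 \/ n = Fin 3 \/ n = Infty)).
Proof.
move=> m2 n2 T; have bm := Tmn_block_metric n2 T.
have [[v _] _] := Tmn_connected T.
split; first exact: (no_SIR bm v).
split=> [loc|[minf nE]].
  by split; [exact: (local_SIR_m bm v)|exact: (local_SIR_n bm v m2 n2 loc)].
case: nE => [n2E|[n3E|ninf]].
- by apply: (local_SIR bm (h := true)) => // _; exists 2.
- by apply: (local_SIR bm (h := true)) => // _; exists 3.
- exact: (local_SIR bm (h := false)).
Qed.
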